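(* Let $\mathbb{C}$ be an initial configuration on $S$ stacks. Consider two virtual layers $V_1,V_2$ that both satisfy P5 and that share exactly one block $w$, where $w$ is WP in $\mathbb{C}$. Suppose the priority of $w$ is lower than the lowest priority of the other $S-1$ stacks (i.e. excluding the stack containing $w$) after removing the blocks lying above both of the two layers. Then in every feasible move sequence for $\mathbb{C}$, either at least 2 non-BG moves are implemented on the blocks of $V_1\cup V_2$, or at least 1 GB move and at least 1 BG move are implemented on the shared block $w$.
   Context: Setting (block relocation problem). There are $S$ stacks and $B$ blocks labelled by $\mathbb{B}=\{1,\dots,B\}$; a smaller label means a higher priority (earlier retrieval). A configuration places blocks in the stacks, each stack being a finite vertical sequence of blocks; the initial configuration $\mathbb{C}$ contains every block exactly once. A stack height limit $H$ may be imposed (each stack holds at most $H$ blocks; $H=\infty$ if there is no limit). A relocation takes the topmost block of a stack and puts it on top of a different stack (respecting the height limit). A retrieval removes from the bay the block of smallest label among those still present, and is allowed only if that block is topmost in its stack. A feasible move sequence is a finite sequence of relocations and retrievals starting from $\mathbb{C}$ after which all blocks have been retrieved. It is assumed that no block is directly retrievable in $\mathbb{C}$ (i.e. block $1$ is not topmost). In a given configuration, a block is badly placed (BP) if some block below it in the same stack has higher priority (smaller label); otherwise it is well placed (WP). A relocation is a BB, BG, GB or GG move, where the first letter is B (resp. G) if the moved block is BP (resp. WP) just before the move, and the second letter is B (resp. G) if it is BP (resp. WP) just after the move. A non-BG move is a BB, GB or GG move. The priority of a stack is the highest priority (smallest label) of a block in it, and $+\infty$ (the lowest priority) if it is empty.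 A virtual layer is a set of $S$ blocks, one from each stack of $\mathbb{C}$. A virtual layer $V$ satisfies P5 if (1) there exists a block lying in $\mathbb{C}$ below the block of $V$ in its stack, whose priority is higher than the highest priority of the blocks in $V$; and (2) the highest priority of the BP blocks (with respect to $\mathbb{C}$) in $V$ is lower than the lowest priority of all stacks after removing the blocks above $V$ (keeping in each stack only the block of $V$ and the blocks below it). For two virtual layers, a block lies above both layers if, in its stack, it is above the block of $V_1$ and above the block of $V_2$; so after removal each stack keeps the upper one of its two layer blocks and everything below it. *)

(* Defs.v *)
From mathcomp Require Import all_boot.

Set Implicit Arguments.
Unset Strict Implicit.
Unset Printing Implicit Defensive.

(* Block [b : 'I_B] is the block of label [b + 1], so the order of labels is the
   order of ['I_B] and [B] lies beyond every label: it serves as +oo.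
   A stack is listed from top to bottom, its head being the topmost block. *)

Definition config (S B : nat) : Type := {ffun 'I_S -> seq 'I_B}.

(* [None] means that there is no height limit. *)
Definition fits (H : option nat) (n : nat) : bool :=
  if H is Some h then n <= h else true.

Definition initial_config (S B : nat) (H : option nat) (c : config S B) : Prop :=
  (forall b : 'I_B, \sum_(s < S) count_mem b (c s) = 1) /\
  (forall s : 'I_S, fits H (size (c s))).

Inductive move (S : nat) : Type :=
| Relocate (src dst : 'I_S)
| Retrieve (src : 'I_S).

Definition smallest_present (S B : nat) (c : config S B) (b : 'I_B) : bool :=
  [exists s, b \in c s] && [forall s, all (fun x : 'I_B => b <= x) (c s)].

Definition retrievable (S B : nat) (c : config S B) (s : 'I_S) : bool :=
  if c s is b :: _ then smallest_present c b else false.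

Definition valid_move (S B : nat) (H : option nat) (c : config S B)
    (m : move S) : bool :=
  match m with
  | Relocate i j => [&& i != j, c i != [::] & fits H (size (c j)).+1]
  | Retrieve i => retrievable c i
  end.

(* Meaningful only for valid moves. *)
Definition do_move (S B : nat) (c : config S B) (m : move S) : config S B :=
  match m with
  | Relocate i j =>
      [ffun s => if s == i then behead (c i)
                 else if s == j then take 1 (c i) ++ c j
                 else c s]
  | Retrieve i => [ffun s => if s == i then behead (c i) else c s]
  end.

Fixpoint feasible (S B : nat) (H : option nat) (c : config S B)
    (ms : seq (move S)) : bool :=
  if ms is m :: ms' then valid_move H c m && feasible H (do_move c m) ms'
  else [forall s, c s == [::]].

Definition below (B : nat) (b : 'I_B) (st : seq 'I_B) : seq 'I_B :=
  drop (index b st).+1 st.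

Definition badly_placed (S B : nat) (c : config S B) (b : 'I_B) : bool :=
  [exists s, (b \in c s) && has (fun x : 'I_B => x < b) (below b (c s))].

Definition well_placed (S B : nat) (c : config S B) (b : 'I_B) : bool :=
  [exists s, b \in c s] && ~~ badly_placed c b.

Definition relocates (S B : nat) (b : 'I_B) (c : config S B) (m : move S) : bool :=
  if m is Relocate i _ then ohead (c i) == Some b else false.

Definition BB_move (S B : nat) (b : 'I_B) (c : config S B) (m : move S) : bool :=
  [&& relocates b c m, badly_placed c b & badly_placed (do_move c m) b].
Definition BG_move (S B : nat) (b : 'I_B) (c : config S B) (m : move S) : bool :=
  [&& relocates b c m, badly_placed c b & well_placed (do_move c m) b].
Definition GB_move (S B : nat) (b : 'I_B) (c : config S B) (m : move S) : bool :=
  [&& relocates b c m, well_placed c b & badly_placed (do_move c m) b].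
Definition GG_move (S B : nat) (b : 'I_B) (c : config S B) (m : move S) : bool :=
  [&& relocates b c m, well_placed c b & well_placed (do_move c m) b].
Definition nonBG_move (S B : nat) (b : 'I_B) (c : config S B) (m : move S) : bool :=
  [|| BB_move b c m, GB_move b c m | GG_move b c m].

(* Number of moves of [ms], played from [c], that satisfy [P] in the
   configuration in which they are made. *)
Fixpoint count_moves (S B : nat) (P : config S B -> move S -> bool)
    (c : config S B) (ms : seq (move S)) : nat :=
  if ms is m :: ms' then P c m + count_moves P (do_move c m) ms' else 0.

Definition stack_priority (B : nat) (st : seq 'I_B) : nat :=
  \big[minn/B]_(b <- st) (b : nat).

Definition highest_priority (B : nat) (A : {set 'I_B}) : nat :=
  \big[minn/B]_(b in A) (b : nat).

Definition virtual_layer (S B : nat) (c : config S B) (V : {set 'I_B}) : Prop :=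
  #|V| = S /\ forall s : 'I_S, count (mem V) (c s) = 1.

(* Keeps the topmost block of [st] belonging to [A] and everything below it.
   For [A] the union of two virtual layers, this removes the blocks lying above
   both layers. *)
Definition remove_above (B : nat) (A : {set 'I_B}) (st : seq 'I_B) : seq 'I_B :=
  drop (find (mem A) st) st.

Definition P5 (S B : nat) (c : config S B) (V : {set 'I_B}) : Prop :=
  (exists (s : 'I_S) (v b : 'I_B),
     [/\ v \in V, v \in c s, b \in below v (c s) & b < highest_priority V]) /\
  \max_(s < S) stack_priority (remove_above V (c s))
    < highest_priority [set v in V | badly_placed c v].

(* Main.v *)
Require Import Defs.
From mathcomp Require Import all_boot.

(** As long as no block of a layer [V] has moved, [V] and everything below it is
    still in place.  If [V] satisfies P5, its first moved block cannot be
    retrieved, because of the block of condition (1), and its relocation is not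
    BG: a WP block is still WP before the move, and a BP block lands by
    condition (2) on a stack holding a smaller label.  So each of the two layers
    contributes a non-BG move.  These two moves coincide only if [w] moves first
    in both layers; this is then a GB move, and since a BP block cannot be
    retrieved, [w] has to be relocated once more, by a BB or a BG move. *)

Set Implicit Arguments.
Unset Strict Implicit.
Unset Printing Implicit Defensive.

Section BlockRelocation.

Variables (S B : nat) (H : option nat).
Implicit Types (c : config S B) (m : move S) (ms : seq (move S)).
Implicit Types (A V : {set 'I_B}) (st : seq 'I_B) (b w x : 'I_B).

(** * Invariants of configurations under valid moves *)

Definition source m : 'I_S :=
  match m with Relocate i _ => i | Retrieve i => i end.

(** Each block occurs at most once: the form of the initial condition that survives retrievals. *)
Definition distinct_blocks c : Prop :=
  (forall s, uniq (c s)) /\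
  (forall s t b, b \in c s -> b \in c t -> s = t).

(** Stacks are listed from the top, so a suffix is a bottom part: [K s] is still in place, possibly
    with blocks above it. *)
Definition keeps (K : 'I_S -> seq 'I_B) c : Prop :=
  forall s, suffix (K s) (c s).

Lemma initial_distinct c : initial_config H c -> distinct_blocks c.
Proof.
case=> c1 _.
have le1 s b : count_mem b (c s) <= 1 by rewrite -(c1 b) (bigD1 s) //= leq_addr.
split=> [s | s t b bs bt].
  apply: count_mem_uniq => b; have := le1 s b.
  by rewrite -has_pred1 has_count; case: (count_mem b (c s)) => [|[]].
(* Two different stacks containing [b] would make the sum at least 2. *)
apply/eqP/negP => /negP st; have := c1 b.
rewrite (bigD1 s) //= (bigD1 t) 1?eq_sym //=.
rewrite -has_pred1 has_count in bs; rewrite -has_pred1 has_count in bt.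
case: (count_mem b (c s)) (count_mem b (c t)) bs bt => [|?] [|?] //.
by rewrite !addSn addnS.
Qed.

Lemma valid_source_nonempty c m :
  valid_move H c m -> exists b st, c (source m) = b :: st.
Proof.
case: m => [i j | i] /=; rewrite /retrievable; last first.
  by case: (c i) => // b st; exists b, st.
by case/and3P=> _; case: (c i) => // b st; exists b, st.
Qed.

Lemma distinct_do_move c m :
  valid_move H c m -> distinct_blocks c -> distinct_blocks (do_move c m).
Proof.
move=> vm [cU cD]; have [b [st ci]] := valid_source_nonempty vm.
case: m vm ci => [i j | i] /= vm ci; have := cU i; rewrite ci /= => /andP[bst stU].
  have ij : i != j by case/and3P: vm.
  have bD t : t != i -> (b \in c t) = false.
    by apply: contraNF => bt; apply/eqP; apply: cD bt _; rewrite ci inE eqxx.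
  have stD t x : t != i -> x \in st -> (x \in c t) = false.
    move=> ti xst; apply: contraNF ti => xt.
    by apply/eqP; apply: cD xt _; rewrite ci inE xst orbT.
  have ji : j != i by rewrite eq_sym.
  (* The two changed stacks, [st] and [b :: c j], are still disjoint. *)
  have stDj x : x \in st -> x \in b :: c j -> False.
    move=> xst; rewrite inE (stD _ _ ji xst) orbF => /eqP xb.
    by rewrite -xb xst in bst.
  split=> [s | s t x]; rewrite !ffunE take0 /=.
    by case: eqP => // _; case: eqP => // _; rewrite /= cU bD.
  have [->|si] := eqVneq s i; have [->|ti] := eqVneq t i => //.
  - by case: eqP => _ xst; [move/(stDj _ xst) | rewrite stD].
  - by case: eqP => _ xs xst; [case: (stDj _ xst) | rewrite stD in xs].
  have [->|sj] := eqVneq s j; have [->|tj] := eqVneq t j => //.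
  - by rewrite inE => /predU1P[-> | xj]; [rewrite bD | apply: cD].
  - by move=> xs; rewrite inE => /predU1P[xb | ]; [rewrite xb bD in xs | apply: cD].
  exact: cD.
have sub s x : x \in (if s == i then st else c s) -> x \in c s.
  by case: eqP => // ->; rewrite ci inE orbC => ->.
split=> [s | s t x]; rewrite !ffunE; first by case: eqP.
by move=> /sub xs /sub; apply: cD xs.
Qed.

(** If the source stack is more than [K], its top block lies above the kept part and can leave; no
    other stack loses a block. *)
Lemma keeps_do_move (K : 'I_S -> seq 'I_B) c m :
  keeps K c -> c (source m) != K (source m) -> keeps K (do_move c m).
Proof.
move=> Kc.
have Kb i : c i != K i -> suffix (K i) (behead (c i)).
  have /suffixP[[|x p] ->] := Kc i; first by rewrite eqxx.
  by move=> _; apply: suffix_suffix.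
case: m => [i j | i] /= /Kb Ki s; rewrite ffunE; case: eqP => [-> // | _] //.
by case: eqP => [-> | _] //; apply: suffix_trans (Kc j) (suffix_suffix _ _).
Qed.

(** * BP blocks and their relocations *)

Lemma badly_placed_split c s p b st :
  distinct_blocks c -> c s = p ++ b :: st ->
  badly_placed c b = has (fun x => x < b) st.
Proof.
move=> [cU cD] cs.
have bs : b \in c s by rewrite cs mem_cat inE eqxx orbT.
have belowE : below b (c s) = st.
  have := cU s; rewrite /below cs cat_uniq /= negb_or -!andbA => /and3P[_ bp _].
  by rewrite index_cat (negPf bp) /= eqxx addn0 -cat_rcons drop_size_cat ?size_rcons.
apply/existsP/idP => [[t /andP[bt]] | hst].
  by rewrite (cD _ _ _ bt bs) belowE.
by exists s; rewrite bs belowE.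
Qed.

Lemma badly_placed_do_relocate c i j b st x :
  i != j -> c i = b :: st -> x \in c j -> x < b ->
  badly_placed (do_move c (Relocate i j)) b.
Proof.
move=> ij ci xj xb; apply/existsP; exists j.
rewrite ffunE eq_sym (negPf ij) eqxx ci /= take0 /below /= inE !eqxx /= drop0.
by apply/hasP; exists x.
Qed.

Lemma well_placed_do_relocate c i j b st :
  i != j -> c i = b :: st ->
  well_placed (do_move c (Relocate i j)) b
    = ~~ badly_placed (do_move c (Relocate i j)) b.
Proof.
move=> ij ci; rewrite /well_placed andb_idl // => _; apply/existsP; exists j.
by rewrite ffunE eq_sym (negPf ij) eqxx ci /= inE eqxx.
Qed.

Lemma smallest_present_le c b s x : smallest_present c b -> x \in c s -> b <= x.
Proof. by case/andP=> _ /forallP/(_ s)/allP; apply. Qed.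

(** The bay is empty at the end, so a nonempty kept part must be disturbed at some point; this
    closes the base cases of the inductions. *)
Lemma feasible_keeps_nil (K : 'I_S -> seq 'I_B) c s :
  feasible H c [::] -> keeps K c -> K s = [::].
Proof.
by move=> /forallP/(_ s)/eqP cs /(_ s); rewrite cs suffixs0 => /eqP.
Qed.

(** As long as [w] has not moved, it rests on [st]. It cannot be retrieved before the smaller [x]
    below it, so its first move is a relocation, made while it is BP. The kept part is empty outside
    [s], so only that stack is constrained. *)
Lemma buried_relocated c ms w s st x :
  x \in st -> x < w -> feasible H c ms ->
  keeps (fun t => if t == s then w :: st else [::]) c ->
  1 <= count_moves (BB_move w) c ms + count_moves (BG_move w) c ms.
Proof.
move=> xst ltxw; elim: ms c => [|m ms IHms] c.
  by move=> fc /(feasible_keeps_nil s fc); rewrite /= eqxx.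
move=> /= /andP[vm fms] Kc.
have [cK|cK] := eqVneq (c (source m))
  (if source m == s then w :: st else [::]); last first.
  have := IHms _ fms (keeps_do_move Kc cK) => /leq_trans; apply.
  by apply: leq_add; apply: leq_addl.
have [b [q cb]] := valid_source_nonempty vm.
(* Any other source would equal its empty kept part, yet a source is nonempty. *)
have sm : source m = s by apply/eqP; move: cK; rewrite cb; case: eqP.
rewrite sm /= eqxx in cK.
case: m vm {fms IHms Kc cb b q} sm => [i j | i] /= vm is_s;
  rewrite -{s}is_s in cK; last first.
  have := vm; rewrite /retrievable cK => /smallest_present_le le_w.
  have xi : x \in c i by rewrite cK inE xst orbT.
  by have := le_w _ _ xi; rewrite leqNgt ltxw.
have ij : i != j by case/and3P: vm.
have wB : badly_placed c w.
  apply/existsP; exists i; rewrite cK inE eqxx /below /= eqxx drop0.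
  by apply/hasP; exists x.
rewrite /BB_move /BG_move (well_placed_do_relocate ij cK) /relocates cK eqxx wB.
by case: (badly_placed _ w); rewrite ?addSn ?addnS.
Qed.

Lemma badly_placed_relocated c ms w :
  feasible H c ms -> badly_placed c w ->
  1 <= count_moves (BB_move w) c ms + count_moves (BG_move w) c ms.
Proof.
move=> fms /existsP[s /andP[ws /hasP[x xw ltxw]]].
apply: (buried_relocated (s := s)) xw ltxw fms _ => t.
case: eqP => [-> | _]; last exact: suffix0s.
by rewrite /below -drop_index // suffix_drop.
Qed.

(** * Removal of upper blocks, and priorities as minima *)

Lemma remove_above_cons A x st :
  remove_above A (x :: st) = if x \in A then x :: st else remove_above A st.
Proof. by rewrite /remove_above /=; case: ifP. Qed.

Lemma remove_above_head A st b q : remove_above A st = b :: q -> b \in A.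
Proof.
elim: st => // x st IHst; rewrite remove_above_cons.
by case: ifP => // xA [<-].
Qed.

(** The topmost block of the union belongs to one of the two sets and is topmost for that set
    too. *)
Lemma remove_aboveU A1 A2 st :
  remove_above (A1 :|: A2) st = remove_above A1 st \/
  remove_above (A1 :|: A2) st = remove_above A2 st.
Proof.
elim: st => [|x st IHst]; first by left.
rewrite !remove_above_cons inE.
by case: (x \in A1); [left | case: (x \in A2); [right | ]].
Qed.

Lemma remove_above_suffix A st : suffix (remove_above A st) st.
Proof. exact: suffix_drop. Qed.

Lemma below_remove_above A st b :
  b \in A -> b \in st -> {subset below b st <= remove_above A st}.
Proof.
move=> bA; elim: st => // x st IHst; rewrite inE /below /= remove_above_cons.
have [-> _ | _ /=] := eqVneq x b.
  by rewrite bA drop0 => y yst; rewrite inE yst orbT.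
move=> /IHst bst y yb; case: ifP => _.
  by rewrite inE (mem_drop yb) orbT.
exact: bst.
Qed.

Lemma stack_priority_le st b : b \in st -> stack_priority st <= b.
Proof.
rewrite /stack_priority; elim: st => // y st IHst.
rewrite big_cons geq_min inE => /predU1P[-> | /IHst ->]; first by rewrite leqnn.
exact: orbT.
Qed.

Lemma highest_priority_le A b : b \in A -> highest_priority A <= b.
Proof.
move=> bA; rewrite /highest_priority -big_filter stack_priority_le //.
by rewrite mem_filter bA mem_index_enum.
Qed.

Lemma stack_priority_lt st b :
  stack_priority st < b -> exists2 x, x \in st & x < b.
Proof.
rewrite /stack_priority; elim: st => [|y st IHst].
  (* The empty stack has priority [B], which exceeds every label. *)
  by rewrite big_nil ltnNge ltnW.
rewrite big_cons gtn_min => /orP[yb | /IHst[x xst xb]].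
  by exists y; rewrite ?inE ?eqxx.
by exists x; rewrite // inE xst orbT.
Qed.

(** * A single layer satisfying P5 *)

Section Layer.

Variables (C : config S B) (V : {set 'I_B}).
Hypothesis P5V : P5 C V.

Local Notation K := (fun s => remove_above V (C s)).

(** The source is exactly its kept part, so the moved block is in [V]. The block of condition (1) is
    still present and smaller than all of [V], which excludes a retrieval. *)
Lemma P5_first_move_relocation c m :
  keeps K c -> valid_move H c m -> c (source m) = K (source m) ->
  exists i j b st,
    [/\ m = Relocate i j, i != j, b \in V, c i = b :: st & K i = b :: st].
Proof.
move=> Kc vm; have [b [st cb]] := valid_source_nonempty vm.
rewrite cb => /esym Kb; have bV := remove_above_head Kb.
case: m vm cb Kb => [i j | i] /= vm cb Kb.
  by exists i, j, b, st; split=> //; case/and3P: vm.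
have [[s [v [x [vV vs xv xV]]]] _] := P5V.
have /suffixP[p cs] := Kc s.
have xc : x \in c s by rewrite cs mem_cat (below_remove_above vV vs xv) orbT.
move: vm; rewrite /retrievable cb => /smallest_present_le/(_ xc).
by rewrite leqNgt (leq_trans xV (highest_priority_le bV)).
Qed.

Hypothesis C_distinct : distinct_blocks C.

(** The blocks under [b] are the same in [c] and in [C]. *)
Lemma badly_placed_kept c i b st :
  distinct_blocks c -> c i = b :: st -> K i = b :: st ->
  badly_placed c b = badly_placed C b.
Proof.
move=> cD ci Ki; rewrite (badly_placed_split (p := [::]) cD ci).
have /suffixP[p Cs] := remove_above_suffix V (C i).
by rewrite /= Ki in Cs; rewrite (badly_placed_split C_distinct Cs).
Qed.

Lemma P5_first_move_nonBG c m :
  distinct_blocks c -> keeps K c -> valid_move H c m ->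
  c (source m) = K (source m) -> [exists b in V, nonBG_move b c m].
Proof.
move=> cD Kc vm cK.
have [i [j [b [st [-> ij bV ci Ki]]]]] := P5_first_move_relocation Kc vm cK.
apply/existsP; exists b; rewrite bV /= /nonBG_move /BB_move /GB_move /GG_move.
rewrite (well_placed_do_relocate ij ci) /relocates ci eqxx /=.
(* A WP block makes a GB or GG move wherever it lands; a BP block needs condition (2). *)
have [bB|bG] := boolP (badly_placed c b); last first.
  suff -> : well_placed c b by case: (badly_placed _ b).
  by rewrite /well_placed bG andbT; apply/existsP; exists i; rewrite ci inE eqxx.
have [_ lt_max] := P5V.
(* The priority of [K j] is at most the maximum in condition (2), and [b] is among the BP blocks of
   [V]. *)
have /stack_priority_lt[x xK xb] : stack_priority (K j) < b.
  apply: leq_ltn_trans (leq_trans lt_max (highest_priority_le _)).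
    exact: (leq_bigmax (F := fun s => stack_priority (K s))).
  by rewrite inE bV -(badly_placed_kept cD ci Ki).
have /suffixP[p cj] := Kc j.
by rewrite (badly_placed_do_relocate ij ci _ xb) // cj mem_cat xK orbT.
Qed.

Lemma P5_nonempty : exists s, K s != [::].
Proof.
have [[s [v [x [vV vs xv _]]]] _] := P5V; exists s.
by have := below_remove_above vV vs xv; case: remove_above.
Qed.

(** Moves above the kept part preserve the invariants; the first move to disturb it is non-BG, and
    there is one since the kept part is not empty. *)
Lemma P5_nonBG c ms :
  distinct_blocks c -> keeps K c -> feasible H c ms ->
  1 <= count_moves (fun c m => [exists b in V, nonBG_move b c m]) c ms.
Proof.
elim: ms c => [|m ms IHms] c cD Kc.
  by move=> fc; have [s] := P5_nonempty; rewrite (feasible_keeps_nil s fc Kc).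
move=> /= /andP[vm fms].
have [cK|cK] := eqVneq (c (source m)) (K (source m)).
  by rewrite P5_first_move_nonBG.
have := IHms _ (distinct_do_move vm cD) (keeps_do_move Kc cK) fms.
by move=> /leq_trans; apply; apply: leq_addl.
Qed.

End Layer.

Lemma count_moves_sub (P Q : config S B -> move S -> bool) c ms :
  (forall c m, P c m -> Q c m) -> count_moves P c ms <= count_moves Q c ms.
Proof.
move=> PQ; elim: ms c => //= m ms IHms c; apply: leq_add => //.
by have := PQ c m; case: (P c m) => // ->.
Qed.

(** * Two layers sharing the block [w] *)

Section TwoLayers.

Variables (C : config S B) (V1 V2 : {set 'I_B}) (w : 'I_B).
Hypotheses (C_distinct : distinct_blocks C) (P51 : P5 C V1) (P52 : P5 C V2).
Hypotheses (V12 : V1 :&: V2 = [set w]) (w_WP : well_placed C w).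
Hypothesis w_low :
  \max_(s < S | w \notin C s) stack_priority (remove_above (V1 :|: V2) (C s)) < w.

Local Notation K1 := (fun s => remove_above V1 (C s)).
Local Notation K2 := (fun s => remove_above V2 (C s)).

(** A move that disturbs both layers takes a block of [V1 :&: V2], hence [w]. It is WP before, as in
    [C], and [w_low] puts a smaller label under it after. *)
Lemma shared_first_move_GB c m :
  distinct_blocks c -> keeps K1 c -> keeps K2 c -> valid_move H c m ->
  c (source m) = K1 (source m) -> c (source m) = K2 (source m) ->
  GB_move w c m.
Proof.
move=> cD K1c K2c vm cK1 cK2.
have [i [j [b [st [mE ij bV1 ci K1i]]]]] := P5_first_move_relocation P51 K1c vm cK1.
rewrite mE /= in cK2 *.
have K2i : K2 i = b :: st by rewrite /= -cK2.
have bw : b = w.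
  by apply/set1P; rewrite -V12 inE bV1 (remove_above_head K2i).
rewrite {b bV1}bw in ci K1i K2i *.
have wC : w \in C i.
  have /suffixP[p ->] := remove_above_suffix V1 (C i).
  by rewrite mem_cat K1i inE eqxx orbT.
(* This makes [j] one of the stacks over which the maximum in [w_low] ranges. *)
have wCj : w \notin C j.
  by apply/negP => wj; case/negP: ij; apply/eqP; apply: C_distinct.2 wC wj.
rewrite /GB_move /relocates ci eqxx /=; apply/andP; split.
  rewrite /well_placed (badly_placed_kept C_distinct cD ci K1i).
  case/andP: w_WP => _ ->; rewrite andbT.
  by apply/existsP; exists i; rewrite ci inE eqxx.
have /stack_priority_lt[x xK xw] :
    stack_priority (remove_above (V1 :|: V2) (C j)) < w.
  apply: leq_ltn_trans w_low.
  exact: (leq_bigmax_cond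
            (F := fun s => stack_priority (remove_above (V1 :|: V2) (C s)))).
apply: badly_placed_do_relocate ij ci _ xw.
(* The part of stack [j] that contains [x] is kept by [V1] or by [V2], and both are still in place
   in [c]. *)
have := K1c j; have := K2c j => /suffixP[p2 c2] /suffixP[p1 c1].
case: (remove_aboveU V1 V2 (C j)) => KE; rewrite KE in xK.
  by rewrite c1 mem_cat xK orbT.
by rewrite c2 mem_cat xK orbT.
Qed.

Local Notation nonBG V := (fun c m => [exists b in V, nonBG_move b c m]).

Lemma nonBG_subset V V' c m :
  V \subset V' -> [exists b in V, nonBG_move b c m] ->
  [exists b in V', nonBG_move b c m].
Proof.
move=> sVV /existsP[b /andP[bV nb]]; apply/existsP; exists b.
by rewrite (subsetP sVV).
Qed.

(** Induction up to the first move that disturbs a layer, split by whether it disturbs both layers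
    or only one. *)
Lemma two_layers_nonBG c ms :
  distinct_blocks c -> keeps K1 c -> keeps K2 c -> feasible H c ms ->
  2 <= count_moves (nonBG (V1 :|: V2)) c ms
  \/ (1 <= count_moves (GB_move w) c ms /\ 1 <= count_moves (BG_move w) c ms).
Proof.
elim: ms c => [|m ms IHms] c cD K1c K2c.
  move=> fc; have [s] := P5_nonempty P51.
  by rewrite (feasible_keeps_nil s fc K1c).
move=> /= /andP[vm fms]; have cD' := distinct_do_move vm cD.
have [cK1|cK1] := eqVneq (c (source m)) (K1 (source m));
  have [cK2|cK2] := eqVneq (c (source m)) (K2 (source m)).
- have wGB := shared_first_move_GB cD K1c K2c vm cK1 cK2.
  have wU : w \in V1 :|: V2.
    by have := set11 w; rewrite -V12 !inE => /andP[->].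
  have -> : [exists b in V1 :|: V2, nonBG_move b c m].
    by apply/existsP; exists w; rewrite wU /nonBG_move wGB orbT.
  have wB : badly_placed (do_move c m) w by case/and3P: wGB.
  (* A later BB move of [w] is a second non-BG move; a later BG move gives the other alternative. *)
  have := badly_placed_relocated fms wB; rewrite addn_gt0 => /orP[hBB | hBG].
    left; apply: (leq_trans hBB); apply: count_moves_sub => c' m' h.
    by apply/existsP; exists w; rewrite wU /nonBG_move h.
  by right; rewrite wGB; split=> //; apply: leq_trans hBG (leq_addl _ _).
(* Only [V1] is disturbed: this move is non-BG, and [V2], still in place, yields another one
   later. *)
- left; rewrite (nonBG_subset (subsetUl V1 V2)); last exact: P5_first_move_nonBG cK1.
  apply: leq_trans (P5_nonBG P52 C_distinct cD' (keeps_do_move K2c cK2) fms) _.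
  by apply: count_moves_sub => c' m'; apply: nonBG_subset (subsetUr _ _).
- left; rewrite (nonBG_subset (subsetUr V1 V2)); last exact: P5_first_move_nonBG cK2.
  apply: leq_trans (P5_nonBG P51 C_distinct cD' (keeps_do_move K1c cK1) fms) _.
  by apply: count_moves_sub => c' m'; apply: nonBG_subset (subsetUl _ _).
(* Neither layer is disturbed, so both invariants pass to the next configuration. *)
have := IHms _ cD' (keeps_do_move K1c cK1) (keeps_do_move K2c cK2) fms.
case=> [h | [hGB hBG]]; first by left; apply: leq_trans h (leq_addl _ _).
by right; split; [apply: leq_trans hGB _ | apply: leq_trans hBG _]; apply: leq_addl.
Qed.

End TwoLayers.

End BlockRelocation.

Theorem theorem4 (S B : nat) (H : option nat) (C : config S B)
    (V1 V2 : {set 'I_B}) (w : 'I_B) :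
  initial_config H C ->
  (forall s : 'I_S, ~~ retrievable C s) ->
  virtual_layer C V1 -> virtual_layer C V2 ->
  P5 C V1 -> P5 C V2 ->
  V1 :&: V2 = [set w] ->
  well_placed C w ->
  \max_(s < S | w \notin C s) stack_priority (remove_above (V1 :|: V2) (C s)) < w ->
  forall ms : seq (move S), feasible H C ms ->
    2 <= count_moves (fun c m => [exists b in V1 :|: V2, nonBG_move b c m]) C ms
    \/ (1 <= count_moves (GB_move w) C ms /\ 1 <= count_moves (BG_move w) C ms).
Proof.
move=> C0 _ _ _ P51 P52 V12 wWP wlow ms fms.
have CD := initial_distinct C0.
have keepsC V : keeps (fun s => remove_above V (C s)) C.
  by move=> s; apply: remove_above_suffix.
exact (two_layers_nonBG CD P51 P52 V12 wWP wlow CD (keepsC V1) (keepsC V2) fms).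
Qed.
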